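(* Let $\theta>0$, and let the parameters $(z,z',\xi)$ vary within the principal or complementary series in such a way that $$\xi\to0,\quad z\to\infty,\quad z'\to\infty,\quad \xi zz'\to\theta.$$ Then the selfadjoint operators $D_{z,z',\xi}$ converge to the selfadjoint operator $D^{\mathrm{Bessel}}_\theta$ in the strong resolvent sense.
   Context: $\mathbb{Z}'=\mathbb{Z}+\tfrac12$ is the lattice of half-integers. $\ell^2_0(\mathbb{Z}')\subset\ell^2(\mathbb{Z}')$ is the dense subspace of finitely supported functions. $(z,z',\xi)$ belongs to the principal series if $z,z'\in\mathbb{C}$ are complex conjugate and nonreal and $0<\xi<1$; it belongs to the complementary series if $z,z'$ are real and both lie in one and the same open interval $(m,m+1)$ with $m\in\mathbb{Z}$, and $0<\xi<1$. In both cases $(z+k)(z'+k)>0$ for all $k\in\mathbb{Z}$. The difference operators $\mathcal{D}_{z,z',\xi}$ and $\mathcal{D}^{\mathrm{Bessel}}_\theta$ act on functions $f$ on $\mathbb{Z}'$ by $$\mathcal{D}_{z,z',\xi}f(x)=\sqrt{\xi(z+x+\tfrac12)(z'+x+\tfrac12)}\,f(x+1)-(x+\xi(z+z'+x))f(x)+\sqrt{\xi(z+x-\tfrac12)(z'+x-\tfrac12)}\,f(x-1)$$ (positive square roots) and $$\mathcal{D}^{\mathrm{Bessel}}_\theta f(x)=\sqrt\theta\, f(x+1)-xf(x)+\sqrt\theta\, f(x-1).$$ Considered as symmetric operators in $\ell^2(\mathbb{Z}')$ with domain $\ell^2_0(\mathbb{Z}')$, both are essentially selfadjoint; $D_{z,z',\xi}$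 and $D^{\mathrm{Bessel}}_\theta$ denote their closures. Strong resolvent convergence $A_n\to A$ of selfadjoint operators means that $(A_n-\lambda)^{-1}\to(A-\lambda)^{-1}$ in the strong operator topology for every $\lambda\in\mathbb{C}\setminus\mathbb{R}$. *)

(* Defs.v *)
From mathcomp Require Import all_boot all_order all_algebra.
From mathcomp Require Import all_classical all_reals all_analysis.
From mathcomp Require Import complex.

Set Implicit Arguments.
Unset Strict Implicit.
Unset Printing Implicit Defensive.

Import Order.TTheory GRing.Theory Num.Theory numFieldNormedType.Exports.
Import ComplexField.Normc.

Local Open Scope classical_set_scope.
Local Open Scope ring_scope.
Local Open Scope complex_scope.

(* The lattice Z' = Z + 1/2 is indexed by [int]: the index [k] stands for the
   half-integer x = k + 1/2, so that x + 1 and x - 1 have indices [k + 1] and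
   [k - 1].  Accordingly a function on Z' is a function on [int]. *)
Definition halfint (K : fieldType) (k : int) : K := k%:~R + 2^-1.

(* [R[i]^o] is the type [R[i]] seen as a normed space over itself; it is the
   carrier on which the library puts the topology of the complex numbers. *)

(* Sum over Z'.  The indices [Posz n] and [Negz n] stand for n + 1/2 and
   - (n + 1/2), so the partial sums run over the x in Z' with |x| < n; all the
   series below are absolutely convergent. *)
Definition zseries (K : numFieldType) (V : normedModType K) (a : int -> V) :
    nat -> V :=
  series (fun n : nat => a (Posz n) + a (Negz n)).

Section ell2.
Variable R : realType.
Notation C := R[i].
Implicit Types (f g u v : int -> C) (A : set ((int -> C) * (int -> C))).

Definition ell2 : set (int -> C) :=
  [set f | cvgn (zseries (fun k => normc (f k) ^+ 2 : R))].

Definition l2norm f : R :=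
  Num.sqrt (limn (zseries (fun k => normc (f k) ^+ 2 : R))).

Definition l2dot f g : C :=
  limn (zseries (fun k => f k * (g k)^* : C^o)).

(* An unbounded operator in l^2(Z') is represented by its graph, the set of the
   pairs (u, A u) with u in the domain of A. *)
Definition operator := set ((int -> C) * (int -> C)).

Definition dense_domain (A : operator) : Prop :=
  forall f, ell2 f -> forall e : R, 0 < e ->
  exists2 p, A p & l2norm (f \- p.1) < e.

Definition adjoint (A : operator) : operator :=
  [set p | [/\ ell2 p.1, ell2 p.2 &
             forall q, A q -> l2dot q.2 p.1 = l2dot q.1 p.2]].

Definition selfadjoint (A : operator) : Prop :=
  dense_domain A /\ A = adjoint A.

Definition op_closure (A : operator) : operator :=
  [set p | [/\ ell2 p.1, ell2 p.2 &
             forall e : R, 0 < e -> exists2 q, A q &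
               l2norm (p.1 \- q.1) < e /\ l2norm (p.2 \- q.2) < e]].

(* [resolvent A lambda g] is the u in the domain of A with A u - lambda u = g;
   this u exists and is unique for g in l^2 when A is selfadjoint and lambda is
   not real (the default value 0 of [xget] is then irrelevant). *)
Definition resolvent (A : operator) (lambda : C) g : int -> C :=
  xget (fun=> 0) [set u | A (u, fun k => lambda * u k + g k)].

(* The strong resolvent convergence is a notion for selfadjoint operators, hence
   the first two clauses, which make all the resolvents below well defined. *)
Definition strong_resolvent_cvg (T : Type) (F : set_system T)
    (A : T -> operator) (B : operator) : Prop :=
  [/\ forall t, selfadjoint (A t),
      selfadjoint B &
      forall lambda : C, lambda \isn't Num.real -> forall g, ell2 g ->
        l2norm (resolvent (A t) lambda g \- resolvent B lambda g)
          @[t --> F] --> (0 : R)].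

(* The operator with domain l^2_0(Z'), the finitely supported functions, that
   acts as the difference operator [D]. *)
Definition finsupp_op (D : (int -> C) -> (int -> C)) : operator :=
  [set p | finite_set [set k | p.1 k != 0] /\ p.2 = D p.1].

(* [sqrtC] is the nonnegative square root: for admissible parameters its
   arguments are positive reals. *)
Definition hyper_diff (z z' : C) (xi : R) f : int -> C := fun k =>
  let x := halfint C k in
  sqrtC (xi%:C * (z + x + 2^-1) * (z' + x + 2^-1)) * f (k + 1)
  - (x + xi%:C * (z + z' + x)) * f k
  + sqrtC (xi%:C * (z + x - 2^-1) * (z' + x - 2^-1)) * f (k - 1).

Definition bessel_diff (theta : R) f : int -> C := fun k =>
  let x := halfint C k in
  (Num.sqrt theta)%:C * f (k + 1) - x * f k
  + (Num.sqrt theta)%:C * f (k - 1).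

Definition hyper_op (z z' : C) (xi : R) : operator :=
  op_closure (finsupp_op (hyper_diff z z' xi)).

Definition bessel_op (theta : R) : operator :=
  op_closure (finsupp_op (bessel_diff theta)).

Definition principal_series (z z' : C) (xi : R) : Prop :=
  [/\ z' = z^*, z \isn't Num.real & 0 < xi < 1].

Definition complementary_series (z z' : C) (xi : R) : Prop :=
  exists a a' : R, exists m : int,
    [/\ z = a%:C, z' = a'%:C, m%:~R < a < (m + 1)%:~R,
        m%:~R < a' < (m + 1)%:~R & 0 < xi < 1].

End ell2.

(* Main.v *)
Require Import Defs.
From mathcomp Require Import all_boot all_order all_algebra.
From mathcomp Require Import all_classical all_reals all_analysis.
From mathcomp Require Import complex zify ring lra.

Set Implicit Arguments.
Unset Strict Implicit.

Import Order.TTheory GRing.Theory Num.Theory numFieldNormedType.Exports.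
Import ComplexField.Normc.
Local Open Scope classical_set_scope.
Local Open Scope ring_scope.
Local Open Scope complex_scope.

(** Both difference operators are Jacobi operators
      (J f)(k) = a_k f(k + 1) + b_k f(k) + a_(k-1) f(k - 1)
    with real coefficients, and the off-diagonal coefficients grow at most
    linearly.  The statement is an instance of a general principle: a pointwise
    limit of the coefficients gives strong resolvent convergence, because the
    finitely supported functions are a common core on which the operators
    converge ([jacobiobi_strong_resolvent]).

    The core.  Let f and J f be square-summable, and multiply f by a cutoff
    which is 1 on the n inner layers and then decreases with slope 1/n.  The
    commutator of J with this cutoff has coefficients of size a_k / n with
    k <= 2n, so it is bounded uniformly in n, and it only sees f outside the
    inner layers; hence it tends to 0.  So f is approximated in the graph norm by
    finitely supported functions ([core_approx]), and the closure of J from the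
    finitely supported functions is the maximal operator
    ([finsupp_jacobiobi_closure]).

    Symmetry.  Summation by parts is exact for finitely supported functions
    ([green_identity]) and extends to the domain of the closure by approximation.
    Testing the adjoint on point masses shows that it is contained in the maximal
    operator, so the closure is selfadjoint ([jacobiobi_selfadjoint]).  The imaginary
    part of the same summation gives |Im l| |f| <= |(J - l) f| on a finite window
    ([window_bound]), hence, up to a factor, on the whole domain
    ([jacobiobi_lower_bound]).

    Resolvents.  By the window bound, the truncation of J - l to a finite window
    is an invertible matrix, and the solutions of the truncated equations are
    bounded in l^2.  A pointwise limit of these solutions along an ultrafilter
    is square-summable and solves (J - l) u = g ([resolvent_exists]), which also
    places it in the domain, since the domain is maximal.

    Convergence.  Let u and w_t be the resolvents of J and J_t applied to g, and
    let q be finitely supported and close to u in the graph norm of J.  Then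
      (J_t - l) (w_t - q) = (J - l) (u - q) + (J - J_t) q,
    where the first term is small, and the second one tends to 0 because it lives
    on finitely many sites.  The lower bound for J_t makes w_t - q small.

    Coefficients.  For the parameters (z, z', xi) the squared off-diagonal entries
    are xi (z + m) (z' + m) with m an integer.  Since xi z z' is bounded and |z'|
    tends to infinity, xi z tends to 0, and likewise xi z'; so these entries
    converge to theta, and the diagonal ones to - x.

    The estimates for sums use |x + y|^2 <= 2 |x|^2 + 2 |y|^2 throughout: only the
    smallness of norms matters, never the constants. *)

(** * Layers of the lattice and symmetric partial sums *)

(** The layer of a site is chosen so that the n-th partial sum of [zseries] runs
    over the sites of layer less than n; the layers of neighbouring sites differ
    by at most 1. *)
Definition layer (k : int) : nat := match k with Posz i => i | Negz i => i end.

Lemma layerS k : (layer (k + 1) <= (layer k).+1)%N.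
Proof. by case: k => [i|[|i]] /=; lia. Qed.

Lemma layerB k : (layer (k - 1) <= (layer k).+1)%N.
Proof. by case: k => [[|i]|i] /=; lia. Qed.

Lemma layerS_ge k : (layer k <= (layer (k + 1)).+1)%N.
Proof. by have := layerB (k + 1); rewrite addrK. Qed.

Lemma layerB_ge k : (layer k <= (layer (k - 1)).+1)%N.
Proof. by have := layerS (k - 1); rewrite subrK. Qed.

Lemma layer_window k (n : nat) : (layer k < n)%N = (- n%:Z <= k < n%:Z).
Proof. by case: k => k /=; lia. Qed.

Lemma finite_layer n : finite_set [set k | (layer k < n)%N].
Proof.
apply: (@sub_finite_set _ _ ((Posz @` `I_n) `|` (Negz @` `I_n))).
  by case=> i /= lt_in; [left|right]; exists i.
by rewrite finite_setU; split; apply: finite_image; exact: finite_II.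
Qed.

Lemma finsuppP (R : realType) (f : int -> R[i]) :
  finite_set [set k | f k != 0] <->
  exists n, forall k, (n <= layer k)%N -> f k = 0.
Proof.
split=> [/finite_seqP[s fs]|[n f0]]; last first.
  apply: sub_finite_set (finite_layer n) => k /=; apply: contraNT.
  by rewrite -leqNgt => /f0 ->.
exists (\max_(k <- s) layer k).+1 => k; apply: contraTeq => fk0.
have ks : k \in s by have : [set k | f k != 0] k by []; rewrite fs.
by rewrite -ltnNge ltnS; exact: leq_bigmax_seq.
Qed.

Section Zseries.
Variables (K : numFieldType) (V : normedModType K).
Implicit Types a b : int -> V.

Lemma zseries0 a : zseries a 0 = 0.
Proof. by rewrite /zseries /series /= big_geq. Qed.

Lemma zseriesS a n : zseries a n.+1 = zseries a n + (a (Posz n) + a (Negz n)).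
Proof. by rewrite /zseries /series /= big_nat_recr. Qed.

Lemma eq_zseries a b n : (forall k, (layer k < n)%N -> a k = b k) ->
  zseries a n = zseries b n.
Proof.
elim: n => [|n IH] ab; first by rewrite !zseries0.
by rewrite !zseriesS IH ?ab ?ab //= => k ?; apply: ab; lia.
Qed.

Lemma zseriesD a b n :
  zseries (fun k => a k + b k) n = zseries a n + zseries b n.
Proof.
elim: n => [|n IH]; first by rewrite !zseries0 addr0.
by rewrite !zseriesS IH [RHS]addrACA; congr (_ + _); rewrite addrACA.
Qed.

Lemma zseriesN a n : zseries (fun k => - a k) n = - zseries a n.
Proof.
elim: n => [|n IH]; first by rewrite !zseries0 oppr0.
by rewrite !zseriesS IH !opprD.
Qed.

Lemma zseriesB a b n :
  zseries (fun k => a k - b k) n = zseries a n - zseries b n.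
Proof. by rewrite zseriesD zseriesN. Qed.

Lemma zseries_stable a n m : (n <= m)%N ->
  (forall k, (n <= layer k)%N -> a k = 0) -> zseries a m = zseries a n.
Proof.
elim: m => [|m IH] nm a0; first by congr zseries; lia.
case: (ltnP m n) => mn; first by congr zseries; lia.
by rewrite zseriesS IH ?a0 ?a0 ?addr0.
Qed.

Lemma zseries_eq0 a n :
  (forall k, (layer k < n)%N -> a k = 0) -> zseries a n = 0.
Proof.
elim: n => [|n IH] a0; first by rewrite zseries0.
by rewrite zseriesS IH ?a0 ?a0 ?addr0 // => j jn; apply: a0; lia.
Qed.

Lemma zseries_single a k n :
  (forall j, j != k -> a j = 0) -> (layer k < n)%N -> zseries a n = a k.
Proof.
move=> a0 kn; rewrite (zseries_stable kn) => [|j kj]; last first.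
  by apply: a0; apply: contraTneq kj => ->; rewrite ltnn.
rewrite zseriesS zseries_eq0 ?add0r => [|j jk]; last first.
  by apply: a0; apply: contraTneq jk => ->; rewrite ltnn.
case: k a0 {kn} => k a0 /=; first by rewrite (a0 (Negz k)) ?addr0.
by rewrite (a0 (Posz k)) ?add0r.
Qed.

Lemma zseries_telescope a n :
  zseries (fun k => a k - a (k - 1)) n.+1 = a n%:Z - a (- n.+2%:Z).
Proof.
elim: n => [|n IH]; rewrite zseriesS.
  rewrite zseries0 add0r addrA.
  have -> : Negz 0 = 0 - 1 by [].
  by rewrite subrK; congr (_ - a _).
have e1 : Posz n.+1 - 1 = n%:Z by lia.
have e2 : Negz n.+1 = - n.+2%:Z by lia.
have e3 : - n.+2%:Z - 1 = - n.+3%:Z by lia.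
by rewrite IH e1 e2 e3 [LHS]addrCA [X in _ + X]addrA subrK addrA subrK.
Qed.

End Zseries.

Lemma ler_zseries (R : realFieldType) (a b : int -> R) n :
  (forall k, (layer k < n)%N -> a k <= b k) -> zseries a n <= zseries b n.
Proof.
elim: n => [|n IH] ab; first by rewrite !zseries0.
rewrite !zseriesS lerD ?lerD ?ab ?ab ?IH //= => k ?; apply: ab; lia.
Qed.

Lemma zseriesZ (R : realFieldType) (c : R) (a : int -> R) n :
  zseries (fun k => c * a k) n = c * zseries a n.
Proof.
elim: n => [|n IH]; first by rewrite !zseries0 mulr0.
by rewrite !zseriesS IH !mulrDr.
Qed.

Lemma zseries_ge0 (R : realFieldType) (a : int -> R) n :
  (forall k, 0 <= a k) -> 0 <= zseries a n.
Proof.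
move=> a0; elim: n => [|n IH]; first by rewrite zseries0.
by rewrite zseriesS !addr_ge0.
Qed.

(** * Square-summable functions *)

Section SquareSummable.
Variable R : realType.
Notation C := R[i].
Implicit Types (x y : C) (f g : int -> C).

(** The squared modulus without its square root, so that inequalities between
    squared norms become polynomial in the real and imaginary parts. *)
Definition nsq x : R := complex.Re x ^+ 2 + complex.Im x ^+ 2.

Lemma normc_sq x : normc x ^+ 2 = nsq x.
Proof. by case: x => a b; rewrite sqr_sqrtr // addr_ge0 ?sqr_ge0. Qed.

Lemma nsq_ge0 x : 0 <= nsq x.
Proof. by rewrite addr_ge0 ?sqr_ge0. Qed.

Lemma nsq0 : nsq 0 = 0.
Proof. by rewrite /nsq /= expr0n addr0. Qed.

Lemma nsqN x : nsq (- x) = nsq x.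
Proof. by case: x => a b; rewrite /nsq /= !sqrrN. Qed.

Lemma nsqM x y : nsq (x * y) = nsq x * nsq y.
Proof. by case: x y => [a b] [c d]; rewrite /nsq /=; ring. Qed.

Lemma nsqR (r : R) : nsq r%:C = r ^+ 2.
Proof. by rewrite /nsq /= expr0n addr0. Qed.

Lemma nsqD x y : nsq (x + y) <= 2 * nsq x + 2 * nsq y.
Proof.
case: x y => [a b] [c d]; rewrite /nsq /= -subr_ge0.
have -> : 2 * (a ^+ 2 + b ^+ 2) + 2 * (c ^+ 2 + d ^+ 2) -
  ((a + c) ^+ 2 + (b + d) ^+ 2) = (a - c) ^+ 2 + (b - d) ^+ 2 by ring.
by rewrite addr_ge0 ?sqr_ge0.
Qed.

Lemma nsqB x y : nsq (x - y) <= 2 * nsq x + 2 * nsq y.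
Proof. by have := nsqD x (- y); rewrite nsqN. Qed.

Lemma nsq_eq0 x : nsq x = 0 -> x = 0.
Proof.
case: x => a b /eqP; rewrite /nsq /= paddr_eq0 ?sqr_ge0 // !sqrf_eq0.
by move=> /andP[/eqP -> /eqP ->].
Qed.

Definition sqsum f : nat -> R := zseries (fun k => nsq (f k) : R).
Definition l2sq f : R := limn (sqsum f).

Lemma sqsumE f : zseries (fun k => normc (f k) ^+ 2 : R) = sqsum f.
Proof. by rewrite /sqsum; congr zseries; apply/funext => k; exact: normc_sq. Qed.

Lemma ell2E f : ell2 f = cvgn (sqsum f).
Proof. by rewrite /ell2 /= sqsumE. Qed.

Lemma l2normE f : l2norm f = Num.sqrt (l2sq f).
Proof. by rewrite /l2norm sqsumE. Qed.

Lemma sqsum_ge0 f n : 0 <= sqsum f n.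
Proof. by apply: zseries_ge0 => k; exact: nsq_ge0. Qed.

Lemma sqsum_nd f : {homo sqsum f : n m / (n <= m)%N >-> n <= m}.
Proof.
apply/nondecreasing_seqP => n; rewrite /sqsum zseriesS lerDl.
by rewrite addr_ge0 ?nsq_ge0.
Qed.

Lemma sqsum_le f n : ell2 f -> sqsum f n <= l2sq f.
Proof. by rewrite ell2E => ?; apply: nondecreasing_cvgn_le => //; exact: sqsum_nd. Qed.

Lemma l2sq_ge0 f : ell2 f -> 0 <= l2sq f.
Proof. by move=> /(sqsum_le 0); apply: le_trans; exact: sqsum_ge0. Qed.

Lemma ell2_le f (B : R) : (forall n, sqsum f n <= B) -> ell2 f /\ l2sq f <= B.
Proof.
move=> fB; have f2 : ell2 f.
  rewrite ell2E; apply: nondecreasing_is_cvgn; first exact: sqsum_nd.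
  by exists B => _ [n _ <-].
split=> //; apply: limr_le; first by move: f2; rewrite ell2E.
exact: nearW.
Qed.

Lemma l2norm_lt f (e : R) : ell2 f -> 0 < e ->
  (l2norm f < e) = (l2sq f < e ^+ 2).
Proof.
move=> f2 e0; rewrite l2normE -(ltr_pXn2r (n := 2)) ?nnegrE ?sqrtr_ge0 ?ltW //.
by rewrite sqr_sqrtr // l2sq_ge0.
Qed.

Lemma nsq_le_l2sq f k : ell2 f -> nsq (f k) <= l2sq f.
Proof.
move=> /(sqsum_le (layer k).+1); apply: le_trans.
rewrite /sqsum zseriesS -[leLHS]add0r lerD //; first exact: sqsum_ge0.
by case: k => k /=; rewrite ?lerDl ?lerDr nsq_ge0.
Qed.

(** All estimates of squared norms below reduce to a pointwise domination of this
    kind. *)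
Lemma ell2_dom2 (c d : R) f g h : 0 <= c -> 0 <= d ->
  (forall k, nsq (f k) <= c * nsq (g k) + d * nsq (h k)) -> ell2 g -> ell2 h ->
  ell2 f /\ l2sq f <= c * l2sq g + d * l2sq h.
Proof.
move=> c0 d0 fgh g2 h2; apply: ell2_le => n.
apply: (@le_trans _ _ (c * sqsum g n + d * sqsum h n)).
  by rewrite /sqsum -!zseriesZ -zseriesD; apply: ler_zseries => k _; exact: fgh.
by apply: lerD; apply: ler_wpM2l => //; exact: sqsum_le.
Qed.

Lemma ell2_dom (c : R) f g : 0 <= c ->
  (forall k, nsq (f k) <= c * nsq (g k)) -> ell2 g ->
  ell2 f /\ l2sq f <= c * l2sq g.
Proof.
move=> c0 fg g2.
have := @ell2_dom2 c 0 f g g c0 (lexx 0) _ g2 g2; rewrite mul0r addr0; apply.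
by move=> k; rewrite mul0r addr0.
Qed.

Lemma ell2D f g : ell2 f -> ell2 g -> ell2 (f \+ g).
Proof.
move=> f2 g2; apply: (proj1 (ell2_dom2 (ler0n R 2) (ler0n R 2) _ f2 g2)) => k.
exact: nsqD.
Qed.

Lemma l2sqD f g : ell2 f -> ell2 g ->
  l2sq (f \+ g) <= 2 * l2sq f + 2 * l2sq g.
Proof.
move=> f2 g2; apply: (proj2 (ell2_dom2 (ler0n R 2) (ler0n R 2) _ f2 g2)) => k.
exact: nsqD.
Qed.

Lemma ell2B f g : ell2 f -> ell2 g -> ell2 (f \- g).
Proof.
move=> f2 g2; apply: (proj1 (ell2_dom2 (ler0n R 2) (ler0n R 2) _ f2 g2)) => k.
exact: nsqB.
Qed.

Lemma l2sqB f g : ell2 f -> ell2 g ->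
  l2sq (f \- g) <= 2 * l2sq f + 2 * l2sq g.
Proof.
move=> f2 g2; apply: (proj2 (ell2_dom2 (ler0n R 2) (ler0n R 2) _ f2 g2)) => k.
exact: nsqB.
Qed.

Lemma ell2Z x f : ell2 f -> ell2 (fun k => x * f k).
Proof.
by move=> f2; apply: (proj1 (ell2_dom (nsq_ge0 x) _ f2)) => k; rewrite nsqM.
Qed.

Lemma l2sqZ x f : ell2 f -> l2sq (fun k => x * f k) <= nsq x * l2sq f.
Proof.
by move=> f2; apply: (proj2 (ell2_dom (nsq_ge0 x) _ f2)) => k; rewrite nsqM.
Qed.

Lemma l2sqBC f g : l2sq (f \- g) = l2sq (g \- f).
Proof.
rewrite /l2sq; congr (limn _); apply/funext => n; apply: eq_zseries => k _.
by rewrite /= -opprB nsqN.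
Qed.

Lemma sqsum_supp f n m : (forall k, (n <= layer k)%N -> f k = 0) ->
  sqsum f m <= sqsum f n.
Proof.
move=> f0; case: (leqP n m) => nm; last by apply: sqsum_nd; exact: ltnW.
by rewrite /sqsum (zseries_stable nm) // => k /f0 ->; rewrite nsq0.
Qed.

Lemma ell2_supp f n : (forall k, (n <= layer k)%N -> f k = 0) ->
  ell2 f /\ l2sq f <= sqsum f n.
Proof. by move=> f0; apply: ell2_le => m; exact: sqsum_supp. Qed.

Lemma sqsum_shift f n : sqsum (fun k => f (k + 1)) n <= sqsum f n.+1.
Proof.
(* The shifted window gains the site n and loses the site - n; the last summand
   on both sides completes the window of size n + 1. *)
suff E : sqsum (fun k => f (k + 1)) n + nsq (f (- n%:Z)) + nsq (f (- n.+1%:Z)) =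
    sqsum f n + nsq (f n) + nsq (f (- n.+1%:Z)).
  rewrite {2}/sqsum zseriesS addrA (_ : Negz n = - n.+1%:Z) ?NegzE // -E.
  by rewrite -addrA lerDl addr_ge0 ?nsq_ge0.
congr (_ + _); elim: n => [|n IH]; first by rewrite /sqsum !zseries0 oppr0.
rewrite /sqsum !zseriesS -!/(sqsum _ _).
have -> : Posz n + 1 = n.+1 by lia.
have -> : Negz n + 1 = - n%:Z by lia.
have -> : - n.+1%:Z = Negz n by lia.
move: IH; lra.
Qed.

Lemma sqsum_unshift f n : sqsum (fun k => f (k - 1)) n <= sqsum f n.+1.
Proof.
(* The shifted window gains the site - n - 1 and loses the site n - 1. *)
suff E : sqsum (fun k => f (k - 1)) n + nsq (f (n%:Z - 1)) + nsq (f n) =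
    sqsum f n + nsq (f (- n.+1%:Z)) + nsq (f n).
  rewrite {2}/sqsum zseriesS [nsq _ + nsq _]addrC addrA.
  rewrite (_ : Negz n = - n.+1%:Z) ?NegzE // -E.
  by rewrite -addrA lerDl addr_ge0 ?nsq_ge0.
congr (_ + _); elim: n => [|n IH]; first by rewrite /sqsum !zseries0.
rewrite /sqsum !zseriesS -!/(sqsum _ _).
have -> : Posz n.+1 - 1 = n by lia.
have -> : Negz n - 1 = - n.+2%:Z by lia.
have -> : Negz n = - n.+1%:Z by lia.
move: IH; lra.
Qed.

Lemma ell2_shift f : ell2 f ->
  ell2 (fun k => f (k + 1)) /\ l2sq (fun k => f (k + 1)) <= l2sq f.
Proof.
by move=> f2; apply: ell2_le => n; apply: le_trans (sqsum_le n.+1 f2); exact: sqsum_shift.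
Qed.

Lemma ell2_unshift f : ell2 f ->
  ell2 (fun k => f (k - 1)) /\ l2sq (fun k => f (k - 1)) <= l2sq f.
Proof.
by move=> f2; apply: ell2_le => n; apply: le_trans (sqsum_le n.+1 f2); exact: sqsum_unshift.
Qed.

Definition tail n f k : C := if (layer k < n)%N then 0 else f k.

(** The inner part and the tail have disjoint supports, so their squared norms
    add up. *)
Lemma sqsum_tail f n m :
  sqsum f n + sqsum (tail n f) m <= sqsum f (maxn n m).
Proof.
elim: m => [|m IH]; first by rewrite /sqsum zseries0 addr0 maxn0.
rewrite [sqsum (tail _ _) _]zseriesS /tail /=.
case: ltnP => mn.
  rewrite nsq0 !addr0; apply: le_trans IH _; apply: sqsum_nd; lia.
have -> : maxn n m.+1 = m.+1 by lia.
move: IH; have -> : maxn n m = m by lia.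
by move=> IH; rewrite [leRHS]zseriesS addrA lerD2r.
Qed.

Lemma ell2_tail f n : ell2 f -> ell2 (tail n f).
Proof.
move=> f2; apply: (proj1 (@ell2_dom 1 _ f _ _ f2)) => // k; rewrite mul1r /tail.
by case: ifP => // _; rewrite nsq0 nsq_ge0.
Qed.

Lemma tail_small f (e : R) : ell2 f -> 0 < e ->
  \forall n \near \oo, l2sq (tail n f) <= e.
Proof.
move=> f2 e0.
have : sqsum f n @[n --> \oo] --> l2sq f by move: f2; rewrite ell2E.
move/cvgrPdist_lt => /(_ _ e0); apply: filterS => n.
rewrite ltr_distl => /andP[_ h].
apply: (proj2 (ell2_le _)) => m.
have := le_trans (sqsum_tail f n m) (sqsum_le _ f2); move: h; lra.
Qed.

End SquareSummable.

(** * Convergence to zero *)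

Lemma le0_eps (R : realFieldType) (x K : R) : (forall e, 0 < e -> x <= K * e) -> x <= 0.
Proof.
move=> h; rewrite leNgt; apply/negP => x0.
have K0 : 0 < `|K| + 1 by rewrite ltr_wpDl.
have := h (x / 2 / (`|K| + 1)) ltac:(by rewrite !divr_gt0).
have : K * (x / 2 / (`|K| + 1)) <= x / 2.
  rewrite mulrA ler_pdivrMr // [K * _]mulrC ler_pM2l ?divr_gt0 //.
  by have := ler_norm K; lra.
lra.
Qed.

Section Limits.
Variables (R : realType) (T : Type) (F : set_system T).
Context {FF : Filter F}.

Lemma cvg_dist_le (u v : T -> R) (x : R) : (forall t, `|x - u t| <= v t) ->
  v t @[t --> F] --> (0 : R) -> u t @[t --> F] --> x.
Proof.
move=> uv /cvgr0Pnorm_lt v0; apply/cvgrPdist_lt => e e0.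
apply: filterS (v0 e e0) => t; apply: le_lt_trans.
exact: le_trans (uv t) (ler_norm _).
Qed.

Lemma cvg_scale0 (v : T -> R) (c : R) :
  v t @[t --> F] --> (0 : R) -> c * v t @[t --> F] --> (0 : R).
Proof.
move=> v0; have h := cvgM (@cvg_cst _ (c : R) _ F _) v0.
by rewrite mulr0 in h; exact: h.
Qed.

Lemma cvg_add0 (u v : T -> R) : u t @[t --> F] --> (0 : R) ->
  v t @[t --> F] --> (0 : R) -> u t + v t @[t --> F] --> (0 : R).
Proof. by move=> u0 v0; have h := cvgD u0 v0; rewrite addr0 in h; exact: h. Qed.

Lemma cvg_dist_sq (s : T -> R) z : s t @[t --> F] --> z ->
  (z - s t) ^+ 2 @[t --> F] --> (0 : R).
Proof.
move=> sz; have zs : z - s t @[t --> F] --> z - z.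
  by apply: (@cvgB _ R^o _ F _ (fun=> z) s z z) => //; exact: cvg_cst.
have h := cvgM zs zs; rewrite subrr mulr0 in h.
rewrite (_ : (fun t => (z - s t) ^+ 2) =
  ((fun t => z - s t) \* (fun t => z - s t))); first exact: h.
by apply/funext => t; rewrite expr2.
Qed.

Lemma cvg0_le (s : T -> R) (e : R) : s t @[t --> F] --> (0 : R) -> 0 < e ->
  \forall t \near F, s t <= e.
Proof.
move=> /cvgr0Pnorm_lt s0 e0; apply: filterS (s0 e e0) => t /ltW.
exact: le_trans (ler_norm _).
Qed.

End Limits.

(** * Jacobi operators and their closure *)

Section Jacobi.
Variable R : realType.
Notation C := R[i].
Implicit Types (a b : int -> R) (f g : int -> C) (M : R).

Definition jacobi a b f : int -> C := fun k =>
  (a k)%:C * f (k + 1) + (b k)%:C * f k + (a (k - 1))%:C * f (k - 1).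

(** The layer is at distance at most 1 from |k|; the successor makes the bound
    meaningful in layer 0. *)
Definition linear_growth a M := forall k, `|a k| <= M * (layer k).+1%:R.

(** The graph of the maximal operator. *)
Definition jacobi_max a b : operator R :=
  [set p | [/\ ell2 p.1, ell2 p.2 & p.2 = jacobi a b p.1]].

Lemma jacobiB a b f g k : jacobi a b (f \- g) k = jacobi a b f k - jacobi a b g k.
Proof. by rewrite /jacobi /=; ring. Qed.

Lemma jacobi_supp a b f n : (forall k, (n <= layer k)%N -> f k = 0) ->
  forall k, (n.+1 <= layer k)%N -> jacobi a b f k = 0.
Proof.
move=> f0 k nk; have := layerS_ge k; have := layerB_ge k => h1 h2.
by rewrite /jacobi !f0 ?mulr0 ?addr0 //; lia.
Qed.

Lemma nsq_jacobi a b f k : nsq (jacobi a b f k) <=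
  4 * a k ^+ 2 * nsq (f (k + 1)) + 4 * b k ^+ 2 * nsq (f k) +
  2 * a (k - 1) ^+ 2 * nsq (f (k - 1)).
Proof.
rewrite /jacobi; apply: le_trans (nsqD _ _) _; rewrite [nsq (_ * f (k - 1))]nsqM nsqR.
have := nsqD ((a k)%:C * f (k + 1)) ((b k)%:C * f k).
rewrite !nsqM !nsqR; lra.
Qed.

(** A trapezoid: 1 up to layer n, then of slope 1/n, and 0 from layer 2n on.  The
    truncated subtraction of natural numbers takes care of the outer region. *)
Definition cutoff n k : R := (minn n (n.*2 - layer k))%:R / n%:R.

Section Cutoff.
Variable n : nat.
Hypothesis n0 : (0 < n)%N.

Let nR0 : (0 : R) < n%:R. Proof. by rewrite ltr0n. Qed.

Lemma cutoff_in k : (layer k <= n)%N -> cutoff n k = 1.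
Proof.
move=> kn; rewrite /cutoff (_ : minn _ _ = n); last by lia.
by rewrite divff // lt0r_neq0.
Qed.

Lemma cutoff_out k : (n.*2 <= layer k)%N -> cutoff n k = 0.
Proof. by move=> kn; rewrite /cutoff (_ : minn _ _ = 0%N) ?mul0r //; lia. Qed.

Lemma cutoff_itv k : 0 <= cutoff n k <= 1.
Proof.
rewrite divr_ge0 ?ler0n //= /cutoff ler_pdivrMr // mul1r ler_nat; lia.
Qed.

Lemma cutoff_lip k l : (layer k <= (layer l).+1)%N -> (layer l <= (layer k).+1)%N ->
  `|cutoff n k - cutoff n l| <= n%:R^-1.
Proof.
move=> kl lk; rewrite /cutoff -mulrBl normrM [`|_^-1|]ger0_norm ?invr_ge0 ?ler0n //.
rewrite -[leRHS]mul1r ler_pM2r ?invr_gt0 // ler_distl lerBlDr !natr1 !ler_nat.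
by apply/andP; split; lia.
Qed.

End Cutoff.

(** The slope 1/n compensates the linear growth: the cutoff varies only up to
    layer 2n, where |a k| <= M (2n + 1) <= 3 M n. *)
Lemma growth_cutoff a M n k : linear_growth a M -> (0 < n)%N ->
  (a k * (cutoff n (k + 1) - cutoff n k)) ^+ 2 <= 9 * M ^+ 2.
Proof.
move=> aM n0; have nR0 : (0 : R) < n%:R by rewrite ltr0n.
have M0 : 0 <= M by apply: le_trans (normr_ge0 _) (le_trans (aM 0) _); rewrite mulr1.
have -> : 9 * M ^+ 2 = (3 * M) ^+ 2 by ring.
rewrite -[leLHS]real_normK ?num_real // ler_pXn2r ?nnegrE ?normr_ge0 ?mulr_ge0 //.
rewrite normrM; case: (leqP n.*2.+1 (layer k)) => kn.
  have := layerS_ge k => kS.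
  by rewrite !cutoff_out ?subrr ?normr0 ?mulr0 ?mulr_ge0 //; lia.
apply: (@le_trans _ _ ((M * (3 * n%:R)) * n%:R^-1)).
  apply: ler_pM => //; last by apply: cutoff_lip => //; [exact: layerS | exact: layerS_ge].
  apply: le_trans (aM k) _; apply: ler_wpM2l => //.
  by rewrite -natrM ler_nat; lia.
by rewrite mulrA mulfK ?lt0r_neq0 // mulrC.
Qed.

(** The diagonal part commutes with multiplication by [c]; only the differences of
    [c] along the edges remain. *)
Lemma jacobi_commutator a b f (c : int -> R) k :
  jacobi a b f k - jacobi a b (fun j => (c j)%:C * f j) k =
  - ((a k * (c (k + 1) - c k))%:C * f (k + 1)
     - (a (k - 1) * (c (k - 1 + 1) - c (k - 1)))%:C * f (k - 1))
  + (1 - c k)%:C * jacobi a b f k.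
Proof. by rewrite /jacobi subrK !rmorphM !rmorphB rmorph1 /=; ring. Qed.

(** The cutoff to n + 1 is constant near the first layers, so each difference
    along an edge that does not vanish has both ends outside the first n layers:
    the right-hand side only involves tails. *)
Lemma cutoff_commutator a b M n f k : linear_growth a M ->
  nsq (jacobi a b f k - jacobi a b (fun j => (cutoff n.+1 j)%:C * f j) k) <=
  36 * M ^+ 2 * nsq (tail n f (k + 1)) + 36 * M ^+ 2 * nsq (tail n f (k - 1)) +
  2 * nsq (tail n (jacobi a b f) k).
Proof.
move=> aM; pose c := cutoff (n.+1).
rewrite (jacobi_commutator a b f c).
have step j l : (layer l <= (layer j).+1)%N -> (layer (j + 1) <= (layer l).+1)%N ->
    (layer j <= (layer l).+1)%N ->
   nsq ((a j * (c (j + 1) - c j))%:C * f l) <= 9 * M ^+ 2 * nsq (tail n f l).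
  move=> lj jl1 jl; rewrite nsqM nsqR /tail; case: ltnP => ln.
    rewrite /c !cutoff_in ?subrr ?mulr0 ?expr0n ?mul0r ?nsq0 ?mulr0 //; lia.
  by rewrite ler_wpM2r ?nsq_ge0 //; exact: growth_cutoff.
have h1 := step k (k + 1) (layerS k) (leqnSn _) (layerS_ge k).
have h2 := step (k - 1) (k - 1) (leqnSn _) (layerS _) (leqnSn _).
have h3 : nsq ((1 - c k)%:C * jacobi a b f k) <= nsq (tail n (jacobi a b f) k).
  rewrite nsqM nsqR /tail; case: ltnP => kn.
    by rewrite /c cutoff_in ?subrr ?expr0n ?mul0r ?nsq0 //; lia.
  rewrite ler_piMl ?nsq_ge0 // expr_le1 //.
    by have := cutoff_itv (ltn0Sn n) k; rewrite -/c; lra.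
  by have := cutoff_itv (ltn0Sn n) k; rewrite -/c; lra.
apply: le_trans (nsqD _ _) _; rewrite nsqN.
have := nsqB ((a k * (c (k + 1) - c k))%:C * f (k + 1))
  ((a (k - 1) * (c (k - 1 + 1) - c (k - 1)))%:C * f (k - 1)).
move: h1 h2 h3; lra.
Qed.

(** The finitely supported functions are a core of the maximal operator: the
    truncations of [f] by the cutoffs converge to [f] in the graph norm, because
    the error is bounded by tails of [f] and [jacobi a b f]. *)
Lemma core_approx a b M f (e : R) : linear_growth a M ->
  ell2 f -> ell2 (jacobi a b f) -> 0 < e ->
  exists q : int -> C, [/\ finite_set [set k | q k != 0], l2sq (f \- q) <= e &
                l2sq (jacobi a b f \- jacobi a b q) <= e].
Proof.
move=> aM f2 Jf2 e0; pose d := e / (1 + 72 * M ^+ 2 + 2).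
(* 72 M^2 + 2 is the constant of [cutoff_commutator]; the summand 1 serves the
   approximation of [f] itself. *)
have D0 : 0 < 1 + 72 * M ^+ 2 + 2 :> R by have := sqr_ge0 M; lra.
have d0 : 0 < d by rewrite divr_gt0.
have [n [fd Jfd]] : exists n, l2sq (tail n f) <= d /\ l2sq (tail n (jacobi a b f)) <= d.
  apply: (@filter_ex _ (nbhs \oo)); apply: filterI; exact: tail_small.
have dE : (1 + 72 * M ^+ 2 + 2) * d = e by rewrite mulrC divfK // lt0r_neq0.
exists (fun j => (cutoff n.+1 j)%:C * f j); split.
- apply/finsuppP; exists n.+1.*2 => k nk.
  by rewrite cutoff_out ?mul0r.
- apply: (@le_trans _ _ (1 * l2sq (tail n f))); last first.
    by have := mulr_ge0 (sqr_ge0 M) (ltW d0); move: dE; nra.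
  apply: (proj2 (ell2_dom ler01 _ (ell2_tail f2))) => k /=.
  have -> : f k - (cutoff n.+1 k)%:C * f k = (1 - cutoff n.+1 k)%:C * f k.
    by rewrite rmorphB rmorph1 /=; ring.
  rewrite mul1r nsqM nsqR /tail; case: ltnP => kn.
    by rewrite cutoff_in ?subrr ?expr0n ?mul0r ?nsq0 //; lia.
  by rewrite ler_piMl ?nsq_ge0 // expr_le1 //; have := cutoff_itv (ltn0Sn n) k; lra.
- have t2 := ell2_tail (n := n) f2; have Jt2 := ell2_tail (n := n) Jf2.
  have [s2 s2le] := ell2_shift t2; have [u2 u2le] := ell2_unshift t2.
  set h := _ \- _.
  have M0 := sqr_ge0 M.
  have M36 : 0 <= 36 * M ^+ 2 by lra.
  pose B := 36 * M ^+ 2 * d + 36 * M ^+ 2 * d + 2 * d.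
  apply: (@le_trans _ _ B); last by rewrite -dE /B; move: d0; lra.
  apply: (proj2 (ell2_le _)) => m.
  apply: (@le_trans _ _ (36 * M ^+ 2 * sqsum (fun k => tail n f (k + 1)) m +
     36 * M ^+ 2 * sqsum (fun k => tail n f (k - 1)) m +
     2 * sqsum (tail n (jacobi a b f)) m)).
    rewrite /sqsum -!zseriesZ -!zseriesD; apply: ler_zseries => k _.
    exact: cutoff_commutator.
  have i1 := le_trans (le_trans (sqsum_le m s2) s2le) fd.
  have i2 := le_trans (le_trans (sqsum_le m u2) u2le) fd.
  have i3 := le_trans (sqsum_le m Jt2) Jfd.
  by rewrite /B; apply: lerD; [apply: lerD; apply: ler_wpM2l | apply: ler_wpM2l].
Qed.

Lemma finsupp_ell2 f : finite_set [set k | f k != 0] -> ell2 f.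
Proof. by move=> /finsuppP[n /ell2_supp[]]. Qed.

Lemma finsupp_jacobi a b f : finite_set [set k | f k != 0] ->
  finite_set [set k | jacobi a b f k != 0].
Proof.
move=> /finsuppP[n f0]; apply/finsuppP.
by exists n.+1; exact: jacobi_supp.
Qed.

(** The difference operator is local, hence continuous for pointwise
    convergence, so its maximal graph is closed. *)
Lemma finsupp_jacobi_closed a b p : op_closure (finsupp_op (jacobi a b)) p ->
  jacobi_max a b p.
Proof.
move=> [p12 p22 H]; split=> //; apply/funext => k; apply/eqP.
rewrite -subr_eq0; apply/eqP/nsq_eq0/eqP; rewrite eq_le nsq_ge0 andbT.
apply: (le0_eps (K := 2 + 2 * (4 * a k ^+ 2 + 4 * b k ^+ 2 + 2 * a (k - 1) ^+ 2))) => e e0.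
have se0 : 0 < Num.sqrt e by rewrite sqrtr_gt0.
have [[q r] [/= qfin ->] [pq pJq]] := H _ se0.
have q2 := finsupp_ell2 qfin; have Jq2 := finsupp_ell2 (finsupp_jacobi a b qfin).
have dq := ell2B p12 q2; have dJq := ell2B p22 Jq2.
move: pq pJq; rewrite (l2norm_lt dq) // (l2norm_lt dJq) // (sqr_sqrtr (ltW e0)) => pq pJq.
have -> : p.2 k - jacobi a b p.1 k = (p.2 k - jacobi a b q k) - jacobi a b (p.1 \- q) k.
  by rewrite jacobiB; ring.
apply: le_trans (nsqB _ _) _.
have h0 := ltW (le_lt_trans (nsq_le_l2sq k dJq) pJq).
have h j := ltW (le_lt_trans (nsq_le_l2sq j dq) pq).
have := nsq_jacobi a b (p.1 \- q) k.
have := ler_wpM2l (sqr_ge0 (a k)) (h (k + 1)).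
have := ler_wpM2l (sqr_ge0 (b k)) (h k).
have := ler_wpM2l (sqr_ge0 (a (k - 1))) (h (k - 1)).
move: h0 => /=; nra.
Qed.

Lemma finsupp_jacobi_closure a b M : linear_growth a M ->
  op_closure (finsupp_op (jacobi a b)) = jacobi_max a b.
Proof.
move=> aM; apply/seteqP; split; first exact: finsupp_jacobi_closed.
case=> f g [/= f2 g2 gE]; split=> //= e e0; rewrite {}gE in g2 *.
have e20 : 0 < e ^+ 2 / 2 by rewrite divr_gt0 // exprn_gt0.
have [q [qfin fq Jfq]] := core_approx aM f2 g2 e20.
exists (q, jacobi a b q) => //=.
have q2 := finsupp_ell2 qfin; have Jq2 := finsupp_ell2 (finsupp_jacobi a b qfin).
by rewrite (l2norm_lt (ell2B f2 q2)) // (l2norm_lt (ell2B g2 Jq2)) //; split; lra.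
Qed.

End Jacobi.

(** * Symmetry *)

Section SymmetricJacobi.
Variable R : realType.
Notation C := R[i].
Implicit Types (a b : int -> R) (f g : int -> C) (M : R) (l : C).

(** Multiply (J - l) f by the conjugate of f and take imaginary parts: the terms
    of J telescope, as the coefficients are real, and leave - Im l |f|^2.  In the
    form used here, the defect of the inequality at each site is a difference
    of the flux [d] along the two edges, which sums to 0, plus the square
    |J f - Re l f|^2. *)
Lemma window_bound a b l f n : (forall k, (n <= layer k)%N -> f k = 0) ->
  complex.Im l ^+ 2 * sqsum f n <= sqsum (fun k => jacobi a b f k - l * f k) n.
Proof.
case: n => [|n] f0; first by rewrite /sqsum !zseries0 mulr0.
pose d k : R := 2 * complex.Im l * a k *
  (complex.Im (f (k + 1)) * complex.Re (f k) - complex.Re (f (k + 1)) * complex.Im (f k)).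
have dn : zseries (fun k => d k - d (k - 1)) n.+1 = 0.
  rewrite zseries_telescope /d f0; last by rewrite /=; lia.
  rewrite (f0 (- n.+2%:Z)) /=; last by lia.
  by ring.
rewrite -[leRHS]addr0 -dn /sqsum -zseriesZ -zseriesD.
apply: ler_zseries => k _; rewrite /d subrK /jacobi /nsq.
case: (f (k + 1)) (f k) (f (k - 1)) l {f0 d dn} => [x y] [u v] [p q] [r c] /=.
rewrite -subr_ge0; set A := a k; set A' := a (k - 1); set B := b k.
set X := (X in 0 <= X).
(* The real and imaginary parts of J f - (Re l) f. *)
have -> : X = (A * x + B * u + A' * p - r * u) ^+ 2
   + (A * y + B * v + A' * q - r * v) ^+ 2.
  by rewrite /X; ring.
by rewrite addr_ge0 ?sqr_ge0.
Qed.

(** The factor 4 comes from passing from the core to the whole domain with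
    |x + y|^2 <= 2 |x|^2 + 2 |y|^2, once for [f] and once for its image. *)
Lemma jacobi_lower_bound a b M l f : linear_growth a M ->
  ell2 f -> ell2 (jacobi a b f) ->
  complex.Im l ^+ 2 * l2sq f <= 4 * l2sq (fun k => jacobi a b f k - l * f k).
Proof.
move=> aM f2 Jf2; set c2 := complex.Im l ^+ 2.
pose h k := jacobi a b f k - l * f k; rewrite -/h.
have h2 : ell2 h := ell2B Jf2 (ell2Z (x := l) f2).
rewrite -subr_le0; apply: (le0_eps (K := 2 * c2 + 8 * (1 + nsq l))) => e e0.
have [q [qfin fq Jfq]] := core_approx aM f2 Jf2 e0.
have q2 := finsupp_ell2 qfin; have Jq2 := finsupp_ell2 (finsupp_jacobi a b qfin).
have fq2 := ell2B f2 q2; have Jfq2 := ell2B Jf2 Jq2.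
have [n q0] := (proj1 (finsuppP _)) qfin.
pose g k := jacobi a b q k - l * q k.
have g2 : ell2 g := ell2B Jq2 (ell2Z (x := l) q2).
have cq : c2 * l2sq q <= l2sq g.
  apply: (@le_trans _ _ (c2 * sqsum q n)).
    by apply: ler_wpM2l; [exact: sqr_ge0 | exact: (proj2 (ell2_supp q0))].
  by apply: le_trans (window_bound _ _ _ q0) _; exact: sqsum_le.
pose r k := (jacobi a b f k - jacobi a b q k) - l * (f k - q k).
have r2 : ell2 r := ell2B Jfq2 (ell2Z (x := l) fq2).
have rle : l2sq r <= 2 * e + 2 * (nsq l * e).
  apply: le_trans (l2sqB Jfq2 (ell2Z (x := l) fq2)) _.
  apply: lerD; apply: ler_wpM2l => //.
  by apply: le_trans (l2sqZ l fq2) _; apply: ler_wpM2l => //; exact: nsq_ge0.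
have gE : g = h \- r by apply/funext => k; rewrite /g /h /r /=; ring.
have gle : l2sq g <= 2 * l2sq h + 2 * l2sq r by rewrite gE; exact: l2sqB.
have fE : f = (f \- q) \+ q by apply/funext => k; rewrite /= subrK.
have fle : l2sq f <= 2 * e + 2 * l2sq q.
  by rewrite [f in leLHS]fE; apply: le_trans (l2sqD fq2 q2) _;
     apply: lerD => //; apply: ler_wpM2l.
have := ler_wpM2l (sqr_ge0 (complex.Im l)) fle; rewrite -/c2.
move: cq gle rle; lra.
Qed.

Lemma conjCR (r : R) : ((r%:C)^*)%R = r%:C :> C.
Proof. by apply/eqP; rewrite eq_complex /= oppr0 !eqxx. Qed.

Lemma conj_jacobi a b g k :
  ((jacobi a b g k)^*)%R = jacobi a b (fun j => ((g j)^*)%R) k.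
Proof. by rewrite /jacobi !rmorphD !rmorphM /= !conjCR. Qed.

(** The difference of the two sums telescopes to boundary values of the
    Wronskian [w], which vanish as soon as the window is larger than the support
    of [f]. *)
Lemma green_identity a b f g n m : (forall k, (n <= layer k)%N -> f k = 0) ->
  (n < m)%N ->
  zseries (fun k => jacobi a b f k * (g k)^* : C^o) m =
  zseries (fun k => f k * (jacobi a b g k)^* : C^o) m.
Proof.
move=> f0; case: m => // m nm; apply/eqP; rewrite -subr_eq0 -zseriesB; apply/eqP.
pose w k : C^o :=
  (a k)%:C * (f (k + 1) * ((g k)^*)%R - f k * ((g (k + 1))^*)%R).
have wm : zseries (fun k => w k - w (k - 1)) m.+1 = 0.
  rewrite zseries_telescope /w !f0 /=; try by lia.
  by rewrite !mul0r !subrr !mulr0 subrr.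
rewrite -[RHS]wm; apply: eq_zseries => k _.
by rewrite conj_jacobi /w subrK /jacobi /=; ring.
Qed.

Lemma normcD (x y : C) : normc (x + y) <= normc x + normc y.
Proof. exact: le_normcD. Qed.

(** A weighted form of the Cauchy-Schwarz inequality: the weight [s] makes the
    bound small when one factor is small and the other merely bounded. *)
Lemma normc_dot_le f g n (s : R) : 0 < s ->
  2 * normc (zseries (fun k => f k * (g k)^* : C^o) n) <=
  s * sqsum f n + s^-1 * sqsum g n.
Proof.
move=> s0.
have term (x y : C) : 2 * normc (x * (y^*)%R) <= s * nsq x + s^-1 * nsq y.
  rewrite -!normc_sq normcM.
  have -> : normc ((y^*)%R) = normc y by case: y => u v; rewrite /= sqrrN.
  set p := normc x; set q := normc y.
  have -> : s * p ^+ 2 + s^-1 * q ^+ 2 = 2 * (p * q) + s^-1 * (s * p - q) ^+ 2.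
    by field; exact: lt0r_neq0.
  by rewrite lerDl mulr_ge0 ?invr_ge0 ?sqr_ge0 ?ltW.
rewrite /sqsum -!zseriesZ -zseriesD.
elim: n => [|n IH]; first by rewrite !zseries0 normc0 mulr0.
rewrite !zseriesS.
have := normcD (zseries (fun k => f k * (g k)^* : C^o) n)
  (f (Posz n) * (g (Posz n))^* + f (Negz n) * (g (Negz n))^*).
have := normcD (f (Posz n) * (g (Posz n))^*) (f (Negz n) * (g (Negz n))^*).
have := term (f (Posz n)) (g (Posz n)); have := term (f (Negz n)) (g (Negz n)).
move: IH; lra.
Qed.

End SymmetricJacobi.

(** * Selfadjointness *)

Section SelfAdjoint.
Variable R : realType.
Notation C := R[i].
Implicit Types (a b : int -> R) (f g : int -> C) (M : R) (l : C).

(** Either both sequences converge, to the same limit, or none does and both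
    limits are the same default value.  So equalities between inner products can
    be proved by comparing partial sums, without discussing their convergence. *)
Lemma lim_eq_of_dist0 (x y : nat -> C^o) :
  (x n - y n @[n --> \oo] --> (0 : C^o)) -> limn x = limn y.
Proof.
move=> xy; have yx : y n - x n @[n --> \oo] --> (0 : C^o).
  by rewrite -oppr0; under eq_fun do rewrite -opprB; exact: cvgN.
rewrite /lim /lim_in; congr (get _); apply/funext => l; apply/propext.
split=> h; first exact: (@cvg_sub0 _ _ _ _ _ y x l yx h).
exact: (@cvg_sub0 _ _ _ _ _ x y l xy h).
Qed.

Lemma cvg0_normc (x : nat -> C^o) :
  (forall e : R, 0 < e -> \forall n \near \oo, normc (x n) < e) ->
  x n @[n --> \oo] --> (0 : C^o).
Proof.
move=> h; apply/cvgr0Pnorm_lt => -[e e']; rewrite ltcE /= => /andP[/eqP e'0 e0].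
apply: filterS (h e e0) => n xe.
by rewrite ltcE /= -e'0 eqxx.
Qed.

(** Replace [f] by a finitely supported [q] close to it in the graph norm: for [q]
    the partial sums agree, and the two error terms are bounded uniformly in the
    number of terms. *)
Lemma l2dot_green a b M f g : linear_growth a M ->
  ell2 f -> ell2 (jacobi a b f) -> ell2 g -> ell2 (jacobi a b g) ->
  l2dot (jacobi a b f) g = l2dot f (jacobi a b g).
Proof.
move=> aM f2 Jf2 g2 Jg2; apply: lim_eq_of_dist0; apply: cvg0_normc => e e0.
(* With this weight the contributions of [g] and [jacobi a b g] to the bound of
   [normc_dot_le] amount to at most e, and those of the two differences to at
   most e / 2; the bound is for twice the modulus. *)
pose s := (l2sq g + l2sq (jacobi a b g) + 1) / e.
have N0 : 0 <= l2sq g + l2sq (jacobi a b g) by rewrite addr_ge0 ?l2sq_ge0.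
have N1 : 0 < l2sq g + l2sq (jacobi a b g) + 1 by lra.
have s0 : 0 < s by rewrite divr_gt0.
have sV : s^-1 * (l2sq g + l2sq (jacobi a b g)) <= e.
  by rewrite /s invf_div mulrAC ler_pdivrMr // ler_pM2l //; lra.
have d0 : 0 < e / (4 * s) by rewrite divr_gt0 // mulr_gt0.
have [q [qfin fq Jfq]] := core_approx aM f2 Jf2 d0.
have q2 := finsupp_ell2 qfin; have Jq2 := finsupp_ell2 (finsupp_jacobi a b qfin).
have [n q0] := (proj1 (finsuppP _)) qfin.
exists n.+1 => // m /= nm.
pose S (u v : int -> C) : C^o := zseries (fun k => u k * ((v k)^*)%R : C^o) m.
have SB u u' v : S (u \- u') v = S u v - S u' v.
  by rewrite /S -zseriesB; apply: eq_zseries => k _; rewrite mulrBl.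
have -> : zseries (fun k => jacobi a b f k * ((g k)^*)%R : C^o) m -
    zseries (fun k => f k * ((jacobi a b g k)^*)%R : C^o) m =
    S (jacobi a b f \- jacobi a b q) g + - S (f \- q) (jacobi a b g).
  have E : S (jacobi a b q) g = S q (jacobi a b g) := green_identity a b g q0 nm.
  by rewrite !SB E opprB addrA subrK.
apply: le_lt_trans (normcD _ _) _.
have -> : normc (- S (f \- q) (jacobi a b g)) = normc (S (f \- q) (jacobi a b g)).
  by case: (S _ _) => u v; rewrite /= !sqrrN.
have fq2 := ell2B f2 q2; have Jfq2 := ell2B Jf2 Jq2.
have h1 := normc_dot_le (jacobi a b f \- jacobi a b q) g m s0.
have h2 := normc_dot_le (f \- q) (jacobi a b g) m s0.
have sV0 : 0 <= s^-1 by rewrite invr_ge0 ltW.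
have i1 := ler_wpM2l (ltW s0) (le_trans (sqsum_le m Jfq2) Jfq).
have i2 := ler_wpM2l (ltW s0) (le_trans (sqsum_le m fq2) fq).
have i3 := ler_wpM2l sV0 (sqsum_le m g2).
have i4 := ler_wpM2l sV0 (sqsum_le m Jg2).
have se : s * (e / (4 * s)) = e / 4 by field; exact: lt0r_neq0.
rewrite se in i1 i2; rewrite -/(S _ _) in h1; rewrite -/(S _ _) in h2.
move: h1 h2 i1 i2 i3 i4 sV e0; lra.
Qed.

Lemma l2dot_delta f k : l2dot (fun j => (j == k)%:R) f = ((f k)^*)%R.
Proof.
have -> : ((f k)^*)%R = limn (fun=> ((f k)^*)%R : C^o).
  by apply/esym/cvg_lim => //; exact: cvg_cst.
apply: lim_eq_of_dist0; apply: cvg0_normc => e e0.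
exists (layer k).+1 => // m /= km.
rewrite (@zseries_single _ _ _ k) // ?eqxx ?mul1r ?subrr ?normc0 //.
by move=> j /negbTE ->; rewrite mul0r.
Qed.

(** The closure is the maximal operator, which is symmetric by [l2dot_green].
    Conversely, testing an element (f, g) of the adjoint on the point mass at k
    gives g(k) = (J f)(k), so the adjoint is contained in the maximal operator. *)
Lemma jacobi_selfadjoint a b M : linear_growth a M ->
  selfadjoint (op_closure (finsupp_op (jacobi a b))).
Proof.
move=> aM; rewrite (finsupp_jacobi_closure b aM); split.
  move=> f f2 e e0.
  have e20 : 0 < e ^+ 2 / 2 by rewrite divr_gt0 // exprn_gt0.
  have [n tn] : exists n, l2sq (tail n f) <= e ^+ 2 / 2.
    by apply: (@filter_ex _ (nbhs \oo)); exact: tail_small.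
  pose q k := if (layer k < n)%N then f k else 0.
  have qfin : finite_set [set k | q k != 0].
    by apply/finsuppP; exists n => k; rewrite /q ltnNge => ->.
  have q2 := finsupp_ell2 qfin; have Jq2 := finsupp_ell2 (finsupp_jacobi a b qfin).
  exists (q, jacobi a b q); first by split.
  have -> : f \- q = tail n f.
    by apply/funext => k; rewrite /= /q /tail; case: ifP; rewrite ?subrr ?subr0.
  rewrite (l2norm_lt (ell2_tail f2)) //; lra.
apply/seteqP; split=> -[f g] [/= f2 g2].
  move=> gE; split=> // -[u v] [/= u2 v2 vE]; rewrite gE in g2 *; rewrite vE in v2 *.
  exact: l2dot_green aM _ _ _ _.
move=> H; split=> //=; apply/funext => k.
pose d (j : int) : C := (j == k)%:R.
have dsupp j : ((layer k).+1 <= layer j)%N -> d j = 0.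
  by rewrite /d; case: eqP => // ->; rewrite ltnn.
have dfin : finite_set [set j | d j != 0] by apply/finsuppP; exists (layer k).+1.
have d2 := finsupp_ell2 dfin; have Jd2 := finsupp_ell2 (finsupp_jacobi a b dfin).
have E : l2dot (jacobi a b d) f = l2dot d g by apply: (H (d, jacobi a b d)); split.
have E' : l2dot (jacobi a b d) f = l2dot d (jacobi a b f).
  apply: lim_eq_of_dist0; apply: cvg0_normc => e e0.
  by exists (layer k).+2 => // m /= km; rewrite (green_identity a b f dsupp km) subrr normc0.
move: E; rewrite E' !l2dot_delta => /esym E.
exact: (inv_inj (@conjCK _)).
Qed.

End SelfAdjoint.

(** * Existence of the resolvent *)

(** An ultrafilter converges to each of its cluster points, and a bounded sequence
    has one by compactness. *)
Lemma ultra_bounded_cvg (R : realType) (U : set_system nat) (s : nat -> R) (B : R) :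
  UltraFilter U -> (forall n, `|s n| <= B) -> exists x : R, s n @[n --> U] --> x.
Proof.
move=> UU sB; have PU : ProperFilter U := ultra_proper.
have sU : fmap s U `[- B, B]%classic.
  by apply: (@filterE _ U _ _ _) => n /=; rewrite in_itv /= -ler_norml.
have [x [_ clx]] := @segment_compact R (- B) B (fmap s U) _ sU.
exists x => A Ax; case: (in_ultra_setVsetC (s @^-1` A) UU) => // nA.
by have [y [? ?]] := clx (~` A) A nA Ax.
Qed.

Section Resolvent.
Variable R : realType.
Notation C := R[i].
Implicit Types (a b : int -> R) (f g : int -> C) (M : R) (l : C).

Section Truncation.
Variables (a b : int -> R) (l : C) (n : nat).

(* Rows and columns of the truncation are numbered from 0 to 2n - 1, which stand
   for the sites from - n to n - 1, that is, the layers less than n. *)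
Let site (i : 'I_(n.*2)) : int := i%:Z - n%:Z.

Let extend (v : 'rV[C]_(n.*2)) (k : int) : C := \sum_i v 0 i * (k == site i)%:R.

(* The matrix acts on row vectors from the right, hence the image of the point
   mass at site i in row i. *)
Let truncation : 'M[C]_(n.*2) := \matrix_(i, j)
  (jacobi a b (fun k => (k == site i)%:R) (site j) - l * (site j == site i)%:R).

Let site_window i : (layer (site i) < n)%N.
Proof. by have := ltn_ord i; rewrite layer_window /site; lia. Qed.

Let window_site k : (layer k < n)%N -> exists i, k = site i.
Proof.
rewrite layer_window => kn; have h : (absz (k + n%:Z)%R < n.*2)%N by lia.
by exists (Ordinal h); rewrite /site /=; lia.
Qed.

Let extend_site v i : extend v (site i) = v 0 i.
Proof.
rewrite /extend (bigD1 i) //= eqxx mulr1 big1 ?addr0 // => j ji.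
rewrite (_ : (site i == site j) = false) ?mulr0 //; apply: contraNF ji => /eqP.
by rewrite /site => e; apply/eqP/val_inj => /=; lia.
Qed.

Let extend_out v k : (n <= layer k)%N -> extend v k = 0.
Proof.
move=> nk; apply: big1 => i _; case: eqP => [ki|]; last by rewrite mulr0.
by have := site_window i; rewrite -ki ltnNge nk.
Qed.

Let mul_truncation v j :
  (v *m truncation) 0 j = jacobi a b (extend v) (site j) - l * extend v (site j).
Proof.
rewrite mxE /jacobi /extend !mulr_sumr -!big_split -sumrB /=.
by apply: eq_bigr => i _; rewrite mxE /jacobi; ring.
Qed.

(** By [window_bound] a solution of the homogeneous system vanishes, so the matrix
    of the truncated system is invertible. *)
Lemma truncated_system g : complex.Im l != 0 ->
  exists f, (forall k, (n <= layer k)%N -> f k = 0) /\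
    (forall k, (layer k < n)%N -> jacobi a b f k - l * f k = g k).
Proof.
move=> l0; have inj (v : 'rV_(n.*2)) : v *m truncation = 0 -> v = 0.
  move=> v0; have f0 := @extend_out v.
  have : sqsum (fun k => jacobi a b (extend v) k - l * extend v k) n = 0.
    apply: zseries_eq0 => k /window_site[j ->].
    by rewrite -mul_truncation v0 mxE nsq0.
  move=> h; have := window_bound a b l f0; rewrite h pmulr_rle0; last first.
    by rewrite lt_neqAle sqr_ge0 eq_sym expf_neq0.
  move=> s0; apply/rowP => i; rewrite mxE -extend_site.
  have [v2 vle] := ell2_supp f0.
  apply: nsq_eq0; apply/eqP; rewrite eq_le nsq_ge0 andbT.
  exact: le_trans (nsq_le_l2sq _ v2) (le_trans vle s0).
have U : truncation \in unitmx by rewrite -row_free_unit; exact: inj_row_free.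
pose v := \row_j g (site j) *m invmx truncation.
exists (extend v); split; first exact: extend_out.
move=> k /window_site[j ->]; rewrite -mul_truncation mulmxKV //.
by rewrite mxE.
Qed.

End Truncation.

Lemma sqsum_cvg0 (T : Type) (F : set_system T) (FF : Filter F) (h : T -> int -> C) m :
  (forall k, nsq (h t k) @[t --> F] --> (0 : R)) ->
  sqsum (h t) m @[t --> F] --> (0 : R).
Proof.
move=> h0; elim: m => [|m IH].
  rewrite (_ : (fun t => _) = fun=> 0); first exact: cvg_cst.
  by apply/funext => t; rewrite /sqsum zseries0.
rewrite (_ : (fun t => _) = fun t => sqsum (h t) m +
    (nsq (h t (Posz m)) + nsq (h t (Negz m)))); last first.
  by apply/funext => t; rewrite /sqsum zseriesS.
exact: (cvg_add0 IH (cvg_add0 (h0 _) (h0 _))).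
Qed.

Lemma nsq_ReIm (x : C) : `|complex.Re x| <= 1 + nsq x /\ `|complex.Im x| <= 1 + nsq x.
Proof.
by rewrite !ler_norml /nsq; case: x => u v /=; split; nra.
Qed.

(** Truncated solutions satisfy |f n|^2 <= |g|^2 / (Im l)^2 by [window_bound].
    Their limit along an ultrafilter inherits the bound, up to a factor, and the
    equation at each site, which involves three values only and holds for all
    large n. *)
Lemma resolvent_exists a b l g : complex.Im l != 0 -> ell2 g ->
  exists u, ell2 u /\ jacobi a b u = fun k => l * u k + g k.
Proof.
move=> l0 g2.
have [f fP] := choice (fun n => truncated_system a b n g l0).
have [U [UU ooU]] := ultraFilterLemma (F := (nbhs \oo : set_system nat)) _.
have PU : ProperFilter U := ultra_proper.
have c0 : 0 < complex.Im l ^+ 2 by rewrite lt_neqAle sqr_ge0 eq_sym expf_neq0.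
pose B := l2sq g / complex.Im l ^+ 2.
have fB n m : sqsum (f n) m <= B.
  have [f0 fE] := fP n; apply: le_trans (sqsum_supp m f0) _.
  rewrite ler_pdivlMr // mulrC; apply: le_trans (window_bound a b l f0) _.
  apply: le_trans _ (sqsum_le n g2); rewrite le_eqVlt; apply/orP; left; apply/eqP.
  by apply: eq_zseries => k /fE ->.
have fkB n k : nsq (f n k) <= B.
  have [f2 fle] := ell2_supp (proj1 (fP n)).
  exact: le_trans (nsq_le_l2sq k f2) (le_trans fle (fB n n)).
have reB k n : `|complex.Re (f n k)| <= 1 + B.
  by apply: le_trans (proj1 (nsq_ReIm _)) _; rewrite lerD2l.
have imB k n : `|complex.Im (f n k)| <= 1 + B.
  by apply: le_trans (proj2 (nsq_ReIm _)) _; rewrite lerD2l.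
have [x xP] := choice (fun k => ultra_bounded_cvg UU (reB k)).
have [y yP] := choice (fun k => ultra_bounded_cvg UU (imB k)).
pose u k : C := x k +i* y k.
have fu k : nsq (u k - f n k) @[n --> U] --> (0 : R).
  rewrite (_ : (fun n => _) = fun n => (x k - complex.Re (f n k)) ^+ 2 +
    (y k - complex.Im (f n k)) ^+ 2); last first.
    by apply/funext => n; rewrite /nsq /u; case: (f n k).
  exact: (cvg_add0 (cvg_dist_sq (xP k)) (cvg_dist_sq (yP k))).
exists u; split.
  apply: (proj1 (@ell2_le _ _ (2 + 2 * B) _)) => m.
  have [n un] := filter_ex (cvg0_le (@sqsum_cvg0 _ U _ (fun n k => u k - f n k) m fu) ltr01).
  apply: (@le_trans _ _ (2 * sqsum (fun k => u k - f n k) m + 2 * sqsum (f n) m)).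
    rewrite /sqsum -!zseriesZ -zseriesD; apply: ler_zseries => k _.
    by have := nsqD (u k - f n k) (f n k); rewrite subrK.
  have := fB n m; move: un; lra.
apply/funext => k; apply/eqP; rewrite -subr_eq0; apply/eqP/nsq_eq0/eqP.
rewrite eq_le nsq_ge0 andbT.
apply: (le0_eps (K := 2 * (4 * a k ^+ 2 + 4 * b k ^+ 2 + 2 * a (k - 1) ^+ 2) + 2 * nsq l)).
move=> e e0.
have [n [nk [h1 [h2 h3]]]] : exists n, [set n | (layer k < n)%N] n /\
   (nsq (u (k + 1) - f n (k + 1)) <= e /\ (nsq (u k - f n k) <= e /\
    nsq (u (k - 1) - f n (k - 1)) <= e)).
  apply: (@filter_ex _ U); apply: filterI; first by apply: ooU; exists (layer k).+1.
  by apply: filterI; [|apply: filterI]; apply: cvg0_le.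
have [_ fE] := fP n.
have -> : jacobi a b u k - (l * u k + g k) =
    jacobi a b (u \- f n) k - l * (u k - f n k).
  by rewrite -(fE k nk) jacobiB; ring.
apply: le_trans (nsqB _ _) _; rewrite nsqM.
have := nsq_jacobi a b (u \- f n) k.
have := ler_wpM2l (sqr_ge0 (a k)) h1.
have := ler_wpM2l (sqr_ge0 (b k)) h2.
have := ler_wpM2l (sqr_ge0 (a (k - 1))) h3.
have := ler_wpM2l (nsq_ge0 l) h2.
rewrite /=; lra.
Qed.

End Resolvent.

(** * Strong resolvent convergence of Jacobi operators *)

Section StrongResolvent.
Variable R : realType.
Notation C := R[i].
Implicit Types (a b : int -> R) (f g : int -> C) (M : R) (l : C).

Lemma Im_nonreal l : l \isn't Num.real -> complex.Im l != 0.
Proof.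
apply: contraNneq; case: l => u v /= ->.
by rewrite realE !lecE /= eqxx /= le_total.
Qed.

(** The function chosen by [resolvent] solves the equation, because a solution
    exists; [ell2] of its image comes from the equation. *)
Lemma resolvent_jacobi a b M l g : linear_growth a M -> l \isn't Num.real -> ell2 g ->
  let u := resolvent (op_closure (finsupp_op (jacobi a b))) l g in
  ell2 u /\ jacobi a b u = fun k => l * u k + g k.
Proof.
move=> aM /Im_nonreal l0 g2 /=; rewrite (finsupp_jacobi_closure b aM).
have [u [u2 uE]] := resolvent_exists a b l0 g2.
have [|] := @xgetPex _ (fun=> 0 : C) [set u | jacobi_max a b (u, fun k => l * u k + g k)] _.
  exists u; split=> //=; exact: ell2D (ell2Z (x := l) u2) g2.
by move=> w2 _ /esym wE; split.
Qed.

(** The growth of the coefficients makes the finitely supported functions a core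
    of each operator; the convergence is then needed on a single [q] of the core,
    close to the limit resolvent in the graph norm, and there only finitely many
    coefficients matter. *)
Lemma jacobi_strong_resolvent (T : Type) (F : set_system T) (FF : Filter F)
    (a_ b_ : T -> int -> R) a b :
  (forall t, exists M, linear_growth (a_ t) M) -> (exists M, linear_growth a M) ->
  (forall k, a_ t k @[t --> F] --> a k) -> (forall k, b_ t k @[t --> F] --> b k) ->
  strong_resolvent_cvg F (fun t => op_closure (finsupp_op (jacobi (a_ t) (b_ t))))
    (op_closure (finsupp_op (jacobi a b))).
Proof.
move=> aM_ [M aM] acvg bcvg; split.
- by move=> t; have [N aN] := aM_ t; exact: jacobi_selfadjoint aN.
- exact: jacobi_selfadjoint aM.
move=> l lR g g2; have l0 := Im_nonreal lR.
set u := resolvent (op_closure _) l g.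
have [u2 uE] : ell2 u /\ jacobi a b u = fun k => l * u k + g k
  := resolvent_jacobi b aM lR g2.
pose w t := resolvent (op_closure (finsupp_op (jacobi (a_ t) (b_ t)))) l g.
have w2 t : ell2 (w t) by have [N aN] := aM_ t; exact: (proj1 (resolvent_jacobi _ aN lR g2)).
have wE t : jacobi (a_ t) (b_ t) (w t) = fun k => l * w t k + g k.
  by have [N aN] := aM_ t; exact: (proj2 (resolvent_jacobi _ aN lR g2)).
have Ju2 : ell2 (jacobi a b u) by rewrite uE; exact: ell2D (ell2Z (x := l) u2) g2.
have c0 : 0 < complex.Im l ^+ 2 by rewrite lt_neqAle sqr_ge0 eq_sym expf_neq0.
(* Twice e for u - q, and twice the bound of w t - q: the lower bound gives the
   factor 4 / (Im l)^2, and its right-hand side is the sum of r, of squared norm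
   at most (2 + 2 |l|^2) e, and of d t, of squared norm at most e. *)
pose K := 2 + 2 * (4 / complex.Im l ^+ 2 * (2 * (2 + 2 * nsq l) + 2)).
have K0 : 0 < K.
  rewrite /K ltr_pwDl // mulr_ge0 // mulr_ge0 //; first by rewrite divr_ge0 // ltW.
  by have := nsq_ge0 l; lra.
suff near_le (e : R) : 0 < e -> \forall t \near F, l2sq (w t \- u) <= K * e.
  apply/cvgr0Pnorm_lt => e e0.
  have e20 : 0 < e ^+ 2 / 2 / K by rewrite !divr_gt0 // exprn_gt0.
  apply: filterS (near_le _ e20) => t; rewrite mulrC divfK ?lt0r_neq0 // => wt.
  rewrite ger0_norm ?l2normE ?sqrtr_ge0 // -l2normE (l2norm_lt (ell2B (w2 t) u2)) //.
  by apply: le_lt_trans wt _; have := exprn_gt0 2 e0; lra.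
move=> e0; have [q [qfin uq Juq]] := core_approx aM u2 Ju2 e0.
have q2 := finsupp_ell2 qfin; have Jq2 := finsupp_ell2 (finsupp_jacobi a b qfin).
have uq2 := ell2B u2 q2; have Juq2 := ell2B Ju2 Jq2.
have [n q0] := (proj1 (finsuppP _)) qfin.
pose d t k := jacobi a b q k - jacobi (a_ t) (b_ t) q k.
have dsupp t k : (n.+1 <= layer k)%N -> d t k = 0.
  by move=> nk; rewrite /d !(jacobi_supp _ _ q0 nk) subrr.
have dcvg k : nsq (d t k) @[t --> F] --> (0 : R).
  pose B t : R := 4 * nsq (q (k + 1)) * (a k - a_ t k) ^+ 2 +
    4 * nsq (q k) * (b k - b_ t k) ^+ 2 +
    2 * nsq (q (k - 1)) * (a (k - 1) - a_ t (k - 1)) ^+ 2.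
  apply: (cvg_dist_le (v := B) _ (cvg_add0 (cvg_add0
    (cvg_scale0 _ (cvg_dist_sq (acvg k))) (cvg_scale0 _ (cvg_dist_sq (bcvg k))))
    (cvg_scale0 _ (cvg_dist_sq (acvg (k - 1)))))) => t.
  rewrite sub0r normrN ger0_norm ?nsq_ge0 //.
  have -> : d t k = jacobi (a \- a_ t) (b \- b_ t) q k.
    by rewrite /d /jacobi /= !rmorphB; ring.
  by apply: le_trans (nsq_jacobi _ _ _ _) _; rewrite /B /=; lra.
have := @sqsum_cvg0 _ _ F FF d n.+1 dcvg.
move/cvg0_le => /(_ e e0); apply: filterS => t dt.
have [dt2 dle] := ell2_supp (dsupp t); have {}dle := le_trans dle dt.
have [N aN] := aM_ t.
have Jtq2 := finsupp_ell2 (finsupp_jacobi (a_ t) (b_ t) qfin).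
have wq2 := ell2B (w2 t) q2.
have Jtw2 : ell2 (jacobi (a_ t) (b_ t) (w t)).
  by rewrite wE; exact: ell2D (ell2Z (x := l) (w2 t)) g2.
have JE : jacobi (a_ t) (b_ t) (w t \- q) =
    jacobi (a_ t) (b_ t) (w t) \- jacobi (a_ t) (b_ t) q.
  by apply/funext => k; rewrite jacobiB.
have Jtwq2 : ell2 (jacobi (a_ t) (b_ t) (w t \- q)) by rewrite JE; exact: ell2B Jtw2 Jtq2.
have bound := jacobi_lower_bound l aN wq2 Jtwq2.
pose r := (jacobi a b u \- jacobi a b q) \- (fun k => l * (u k - q k)).
have r2 : ell2 r := ell2B Juq2 (ell2Z (x := l) uq2).
have rle : l2sq r <= 2 * e + 2 * (nsq l * e).
  apply: le_trans (l2sqB Juq2 (ell2Z (x := l) uq2)) _.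
  apply: lerD; apply: ler_wpM2l => //.
  by apply: le_trans (l2sqZ l uq2) _; apply: ler_wpM2l => //; exact: nsq_ge0.
(* (J_t - l) (w_t - q) = (J - l) (u - q) + (J - J_t) q, as both u and w_t solve
   the equation with right-hand side g. *)
have hE : (fun k => jacobi (a_ t) (b_ t) (w t \- q) k - l * (w t \- q) k) = r \+ d t.
  by apply/funext => k; rewrite jacobiB wE /r /d /= uE; ring.
rewrite hE in bound.
have rd := l2sqD r2 dt2.
have qu2 := ell2B q2 u2.
have uE' : w t \- u = (w t \- q) \+ (q \- u)
  by apply/funext => k; rewrite /= addrA subrK.
rewrite uE'; apply: le_trans (l2sqD wq2 qu2) _.
rewrite -(l2sqBC u q).
have : l2sq (w t \- q) <= 4 / complex.Im l ^+ 2 * (2 * (2 + 2 * nsq l) + 2) * e.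
  rewrite -(ler_pM2l c0).
  have -> : complex.Im l ^+ 2 * (4 / complex.Im l ^+ 2 * (2 * (2 + 2 * nsq l) + 2) * e)
      = 4 * (2 * (2 + 2 * nsq l) + 2) * e by field.
  by apply: le_trans bound _; move: rd rle dle; lra.
by rewrite /K; set Q := 4 / _ * _; move: uq; lra.
Qed.

End StrongResolvent.

(** * Coefficients of the two difference operators *)

Section DifferenceOperators.
Variable R : realType.
Notation C := R[i].

Lemma normc_ge_Re (x : C) : `|complex.Re x| <= normc x.
Proof.
case: x => u v /=; rewrite -sqrtr_sqr ler_sqrt ?lerDl ?sqr_ge0 //.
by rewrite addr_ge0 ?sqr_ge0.
Qed.

Lemma normc_real (r : R) : normc (r%:C : C) = `|r|.
Proof. by rewrite /= expr0n addr0 sqrtr_sqr. Qed.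

Lemma normc_opp (x : C) : normc (- x) = normc x.
Proof. by case: x => u v /=; rewrite !sqrrN. Qed.

Lemma normc_ge0 (x : C) : 0 <= normc x.
Proof. by case: x => u v; exact: sqrtr_ge0. Qed.

Lemma sqrtC_real (r : R) : 0 <= r -> sqrtC (r%:C : C) = (Num.sqrt r)%:C.
Proof.
move=> r0; rewrite -{1}(sqr_sqrtr r0) rmorphXn /= sqrCK //.
by rewrite lecE /= eqxx sqrtr_ge0.
Qed.

Lemma ge0_complexE (x : C) : 0 <= x -> x = (complex.Re x)%:C /\ 0 <= complex.Re x.
Proof. by case: x => u v; rewrite lecE /= => /andP[/eqP -> ->]. Qed.

Section Admissible.
Variables (z z' : C) (xi : R).

(** The square of the coefficient between the sites of indices m - 1 and m, that
    is, between the half-integers m - 1/2 and m + 1/2. *)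
Definition sq_coef (m : int) : C := xi%:C * (z + m%:~R) * (z' + m%:~R).

Definition hyper_a (k : int) : R := Num.sqrt (complex.Re (sq_coef (k + 1))).

Definition hyper_b (k : int) : R :=
  - (halfint R k + xi * (complex.Re (z + z') + halfint R k)).

Lemma intr_complex (m : int) : (m%:~R : C) = (m%:~R : R)%:C.
Proof. by rewrite rmorph_int. Qed.

(** In the principal series the product is xi |z + m|^2; in the complementary
    series no integer separates z from z', so both factors have the same sign. *)
Lemma admissible : principal_series z z' xi \/ complementary_series z z' xi ->
  [/\ 0 < xi, complex.Im (z + z') = 0 & forall m, 0 <= sq_coef m].
Proof.
rewrite /sq_coef.
case=> [[-> _ /andP[xi0 _]]|[u [u' [j [
  -> -> /andP[ju uj] /andP[ju' uj'] /andP[xi0 _]]]]]].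
  split=> // [|m]; first by case: z => x y /=; rewrite subrr.
  rewrite intr_complex; case: z => x y; rewrite lecE /=.
  apply/andP; split; first by apply/eqP; ring.
  have -> : (xi * (x + m%:~R) - 0 * (y + 0)) * (x + m%:~R) -
    (xi * (y + 0) + 0 * (x + m%:~R)) * (- y + 0) =
    xi * ((x + m%:~R) ^+ 2 + y ^+ 2) by ring.
  by apply: mulr_ge0; [exact: ltW | rewrite addr_ge0 ?sqr_ge0].
split=> // [|m]; first by rewrite /= addr0.
rewrite intr_complex -!rmorphD -!rmorphM lecE /= eqxx /= -mulrA.
apply: mulr_ge0; first exact: ltW.
(* z and z' lie between j and j + 1, so the common sign of the two factors
   changes at m = - j. *)
case: (lerP (- j) m) => jm.
  have : (- j)%:~R <= m%:~R :> R by rewrite ler_int.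
  by rewrite rmorphN /= => ?; apply: mulr_ge0; lra.
have : (m + 1)%:~R <= (- j)%:~R :> R by rewrite ler_int lezD1.
rewrite rmorphN rmorphD /= => ?; rewrite rmorphD /= in uj uj'.
by apply: mulr_le0; lra.
Qed.

Hypothesis adm : principal_series z z' xi \/ complementary_series z z' xi.

Lemma hyper_diffE : hyper_diff z z' xi = jacobi hyper_a hyper_b.
Proof.
have [xi0 im0 w0] := admissible adm.
apply/funext => f; apply/funext => k; rewrite /hyper_diff /jacobi /hyper_a subrK.
have wE m : sqrtC (sq_coef m) = (Num.sqrt (complex.Re (sq_coef m)))%:C.
  by have [wE wge] := ge0_complexE (w0 m); rewrite [in LHS]wE sqrtC_real.
rewrite -!wE /sq_coef.
have e1 y : y + halfint C k + 2^-1 = y + (k + 1)%:~R.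
  by rewrite /halfint rmorphD /=; field.
have e2 y : y + halfint C k - 2^-1 = y + k%:~R by rewrite /halfint; field.
rewrite !e1 !e2; congr (_ + _ + _); rewrite -mulNr; congr (_ * _).
have hE : halfint C k = (halfint R k)%:C.
  by rewrite /halfint rmorphD intr_complex fmorphV /= rmorph_nat.
have sE : z + z' = (complex.Re (z + z'))%:C.
  by apply/eqP; rewrite eq_complex im0 !eqxx.
rewrite /hyper_b hE sE; move: (complex.Re (z + z')) (halfint R k) => r h.
by rewrite rmorphN rmorphD rmorphM rmorphD /=; ring.
Qed.

Lemma Re_sq_coef m : complex.Re (sq_coef m) =
  xi * normc (z + m%:~R) * normc (z' + m%:~R).
Proof.
have [xi0 _ w0] := admissible adm.
have [wE wge] := ge0_complexE (w0 m).
rewrite -[LHS]ger0_norm // -normc_real -wE /sq_coef !normcM normc_real.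
by rewrite ger0_norm // ltW.
Qed.

Lemma normc_int (m : int) : normc (m%:~R : C) = `|m%:~R : R|.
Proof. by rewrite intr_complex normc_real. Qed.

Lemma layer_norm k : `|(k + 1)%:~R : R| <= (layer k).+1%:R.
Proof. by rewrite -intr_norm -[_.+1%:R]/(_.+1%:Z%:~R) ler_int; case: k => k /=; lia. Qed.

(** As xi <= 1, the squared coefficient is at most (|z| + |m|) (|z'| + |m|). *)
Lemma hyper_growth : linear_growth hyper_a (normc z + normc z' + 1).
Proof.
have [xi0 _ w0] := admissible adm.
have xi1 : xi <= 1.
  by case: adm => [[_ _ /andP[_ /ltW]]|[u [u' [j [_ _ _ _ /andP[_ /ltW]]]]]].
move=> k; set L : R := (layer k).+1%:R; set m := k + 1.
have L1 : 1 <= L by rewrite ler1n.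
have mL y : normc (y + m%:~R) <= normc y + L.
  by apply: le_trans (normcD _ _) _; rewrite lerD2l normc_int layer_norm.
have z0 := normc_ge0 z; have z'0 := normc_ge0 z'.
rewrite ger0_norm ?sqrtr_ge0 // -(@ler_pXn2r _ 2) ?nnegrE ?sqrtr_ge0 //; last first.
  by apply: mulr_ge0; lra.
rewrite sqr_sqrtr; last exact: (proj2 (ge0_complexE (w0 _))).
rewrite Re_sq_coef -mulrA.
apply: (@le_trans _ _ ((normc z + L) * (normc z' + L))); last first.
  by rewrite expr2; apply: ler_pM; nra.
rewrite -[leRHS]mul1r; apply: ler_pM => //; first exact: ltW.
  by apply: mulr_ge0; exact: normc_ge0.
by apply: ler_pM => //; exact: normc_ge0.
Qed.

End Admissible.

Lemma bessel_diffE (theta : R) :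
  bessel_diff theta = jacobi (fun=> Num.sqrt theta) (fun k => - halfint R k).
Proof.
apply/funext => f; apply/funext => k; rewrite /bessel_diff /jacobi.
rewrite (_ : halfint C k = (halfint R k)%:C); last first.
  by rewrite /halfint rmorphD intr_complex fmorphV /= rmorph_nat.
by rewrite rmorphN /= mulNr.
Qed.

End DifferenceOperators.

Section ParameterLimits.
Variables (R : realType) (T : Type) (F : set_system T).
Context {FF : Filter F}.
Notation C := R[i].

(** Applied to u = xi |z| and p = |z'|, whose product xi |z z'| stays bounded. *)
Lemma cvg_bounded_over_infty (u p : T -> R) (B : R) :
  (\forall t \near F, 0 <= u t * p t <= B) -> (forall t, 0 <= u t) ->
  p t @[t --> F] --> +oo -> u t @[t --> F] --> (0 : R).
Proof.
move=> upB u0 /cvgryPgt poo; apply/cvgr0Pnorm_lt => e e0.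
apply: filterS2 upB (poo ((`|B| + 1) / e)) => t /andP[_ upt].
have B1 : 0 < `|B| + 1 by rewrite ltr_wpDl.
rewrite ltr_pdivrMr // => pe.
have pt0 : 0 < p t by rewrite -(pmulr_lgt0 _ e0); apply: lt_trans pe.
rewrite ger0_norm // -(ltr_pM2r pt0); apply: le_lt_trans upt _.
by rewrite mulrC; apply: le_lt_trans pe; have := ler_norm B; lra.
Qed.

Lemma cvg_normc (x : T -> C) (l : C) : (x t : C^o) @[t --> F] --> (l : C^o) ->
  normc (l - x t) @[t --> F] --> (0 : R).
Proof.
move=> /cvgrPdist_lt h; apply/cvgr0Pnorm_lt => e e0.
have := h e%:C; rewrite ltcR => /(_ e0); apply: filterS => t.
by move=> xe; rewrite (ger0_norm (normc_ge0 _)) -ltcR; exact: xe.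
Qed.

End ParameterLimits.

Theorem proposition4p3 (R : realType) (theta : R) (T : Type)
    (F : set_system T) (FF : Filter F) (z z' : T -> R[i]) (xi : T -> R) :
  0 < theta ->
  (forall t : T, principal_series (z t) (z' t) (xi t) \/
                 complementary_series (z t) (z' t) (xi t)) ->
  xi t @[t --> F] --> (0 : R) ->
  normc (z t) @[t --> F] --> +oo ->
  normc (z' t) @[t --> F] --> +oo ->
  ((xi t)%:C * z t * z' t : R[i]^o) @[t --> F] --> (theta%:C : R[i]^o) ->
  strong_resolvent_cvg F (fun t => hyper_op (z t) (z' t) (xi t))
    (bessel_op theta).
Proof.
move=> theta0 adm xi0 zoo z'oo zz'.
have -> : (fun t => hyper_op (z t) (z' t) (xi t)) = (fun t => op_closure
    (finsupp_op (jacobi (hyper_a (z t) (z' t) (xi t)) (hyper_b (z t) (z' t) (xi t))))).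
  by apply/funext => t; rewrite /hyper_op hyper_diffE.
rewrite /bessel_op bessel_diffE.
have xi_gt0 t : 0 < xi t by have [] := admissible (adm t).
pose p t : R := normc ((xi t)%:C * z t * z' t).
pose d t : R := normc (theta%:C - (xi t)%:C * z t * z' t).
have d0 : d t @[t --> F] --> (0 : R) by exact: cvg_normc zz'.
have pE t : p t = xi t * normc (z t) * normc (z' t).
  by rewrite /p !normcM normc_real ger0_norm // ltW.
have p_bound : \forall t \near F, 0 <= p t <= theta + 1.
  move/cvgr0Pnorm_lt : (d0) => dn; apply: filterS (dn 1 ltr01) => t.
  rewrite ger0_norm ?normc_ge0 //= => dt.
  have := normcD theta%:C ((xi t)%:C * z t * z' t - theta%:C).
  rewrite addrC subrK normc_real (ger0_norm (ltW theta0)) -/(p t).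
  have -> : normc ((xi t)%:C * z t * z' t - theta%:C) = d t.
    by rewrite /d -normc_opp opprB.
  by move: dt; lra.
have xiz : xi t * normc (z t) @[t --> F] --> (0 : R).
  apply: (cvg_bounded_over_infty (B := theta + 1) _ _ z'oo).
    by apply: filterS p_bound => t; rewrite pE.
  by move=> t; rewrite mulr_ge0 ?normc_ge0 // ltW.
have xiz' : xi t * normc (z' t) @[t --> F] --> (0 : R).
  apply: (cvg_bounded_over_infty (B := theta + 1) _ _ zoo).
    by apply: filterS p_bound => t; rewrite pE mulrAC.
  by move=> t; rewrite mulr_ge0 ?normc_ge0 // ltW.
apply: jacobi_strong_resolvent.
- by move=> t; eexists; exact: hyper_growth.
- by exists (Num.sqrt theta) => k; rewrite ger0_norm ?sqrtr_ge0 // ler_peMr ?sqrtr_ge0 // ler1n.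
- move=> k; rewrite /hyper_a; set m := k + 1; pose M : R := `|m%:~R|.
  have root_cvg (w : T -> R) : w t @[t --> F] --> theta ->
      Num.sqrt (w t) @[t --> F] --> Num.sqrt theta.
    by move=> wcvg; apply: continuous_cvg wcvg; exact: sqrt_continuous.
  apply: root_cvg.
  apply: (cvg_dist_le _ (cvg_add0 (cvg_add0 d0 (cvg_scale0 M (cvg_add0 xiz xiz')))
    (cvg_scale0 (M ^+ 2) xi0))) => t.
  pose y := theta%:C - sq_coef (z t) (z' t) (xi t) m.
  have -> : theta - complex.Re (sq_coef (z t) (z' t) (xi t) m) = complex.Re y.
    by rewrite /y; case: (sq_coef _ _ _ _).
  apply: le_trans (normc_ge_Re _) _.
  (* Expand xi (z + m) (z' + m) in powers of m. *)
  have -> : y = theta%:C - (xi t)%:C * z t * z' t +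
      (- m%:~R * ((xi t)%:C * (z t + z' t)) + - m%:~R ^+ 2 * (xi t)%:C).
    by rewrite /y /sq_coef; ring.
  apply: le_trans (normcD _ _) _; rewrite -addrA lerD2l.
  apply: le_trans (normcD _ _) _; rewrite !normcM !normc_opp normc_int -/M.
  rewrite expr2 !normcM !normc_int normc_real (gtr0_norm (xi_gt0 t)) -expr2 lerD2r.
  apply: ler_wpM2l; first exact: normr_ge0.
  by rewrite -mulrDr; apply: ler_wpM2l; [exact: ltW | exact: normcD].
- move=> k; apply: (cvg_dist_le _ (cvg_add0 (cvg_add0 xiz xiz')
    (cvg_scale0 `|halfint R k| xi0))) => t; rewrite /hyper_b.
  set s := complex.Re _; set x := halfint R k.
  have -> : - x - - (x + xi t * (s + x)) = xi t * (s + x) by ring.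
  rewrite normrM (gtr0_norm (xi_gt0 t)) -mulrDr [`|x| * _]mulrC -mulrDr.
  apply: ler_wpM2l; first exact: ltW.
  apply: le_trans (ler_normD _ _) _; rewrite lerD2r.
  exact: le_trans (normc_ge_Re _) (normcD _ _).
Qed.
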